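(* Consider $z_0\in\widetilde{\mathrm B}^+_{n+1}\subset\operatorname{Spin}_{n+1}$ and $\sigma=\sigma_{z_0}\in S_{n+1}$ with $\sigma\ne\eta$, and let $k=\operatorname{inv}(\eta)-\operatorname{inv}(\sigma)>0$. There exist an open neighborhood $\mathcal U_{z_0}$ of the (non-open) signed Bruhat cell $\operatorname{Bru}_{z_0}$ in $\operatorname{Spin}_{n+1}$ and a smooth map $f=(f_1,\ldots,f_k):\mathcal U_{z_0}\to\mathbb R^k$ with the following properties. (i) For all $z\in\mathcal U_{z_0}$, $z\in\operatorname{Bru}_{z_0}$ if and only if $f(z)=0$. (ii) For all $z\in\mathcal U_{z_0}$, the derivative $Df(z)$ is surjective. (iii) For any smooth locally convex curve $\Gamma:(-\epsilon,\epsilon)\to\mathcal U_{z_0}$ we have $(f_k\circ\Gamma)'(t)>0$ for all $t\in(-\epsilon,\epsilon)$.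
   Context: Fix an integer $n\ge2$. $S_{n+1}$ is the group of permutations of $\{1,\ldots,n+1\}$ acting on the right, $(\sigma,k)\mapsto k^\sigma$. $\operatorname{inv}(\sigma)$ is the number of pairs $i<j$ with $i^\sigma>j^\sigma$. $\eta\in S_{n+1}$ is the permutation $j^\eta=n+2-j$, with $\operatorname{inv}(\eta)=n(n+1)/2$ maximal. $\Pi:\operatorname{Spin}_{n+1}\to\operatorname{SO}_{n+1}$ is the universal (double) covering homomorphism; the Lie algebra of $\operatorname{Spin}_{n+1}$ is identified with $\mathfrak{so}_{n+1}$ via $\Pi$. $\mathfrak a_j\in\mathfrak{so}_{n+1}$ ($1\le j\le n$) has nonzero entries only $(\mathfrak a_j)_{j+1,j}=1$, $(\mathfrak a_j)_{j,j+1}=-1$. $\mathrm B^+_{n+1}\subset\operatorname{SO}_{n+1}$ is the group of signed permutation matrices of determinant $1$, and $\widetilde{\mathrm B}^+_{n+1}=\Pi^{-1}[\mathrm B^+_{n+1}]$. For $z\in\widetilde{\mathrm B}^+_{n+1}$ with $P=\Pi(z)$, $\sigma_z\in S_{n+1}$ is defined by $e_j^\top P=\pm e_{j^{\sigma_z}}^\top$ for all $j$. $\operatorname{Up}^+_{n+1}$ is the group of real upper triangular $(n+1)\times(n+1)$ matrices with strictly positive diagonal entries. For $z\in\widetilde{\mathrm B}^+_{n+1}$ with $P=\Pi(z)$, the signed Bruhat cell $\operatorname{Bru}_z\subset\operatorname{Spin}_{n+1}$ is the connected component containing $z$ of $\Pi^{-1}\big[(\operatorname{Up}^+_{n+1}P\operatorname{Up}^+_{n+1})\cap\operatorname{SO}_{n+1}\big]$;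 it is a contractible submanifold of dimension $\operatorname{inv}(\sigma_z)$. A map $\Gamma:J\to\operatorname{Spin}_{n+1}$ on an interval $J\subseteq\mathbb R$ is a locally convex curve if it is absolutely continuous and, wherever its derivative is defined, $(\Gamma(t))^{-1}\Gamma'(t)=\sum_{j=1}^n\kappa_j(t)\mathfrak a_j$ with $\kappa_j(t)>0$ for all $j$. *)

(* Defs.v *)
From HB Require Import structures.
From mathcomp Require Import all_boot all_order all_algebra perm.
From mathcomp Require Import all_classical all_reals all_analysis.
Set Implicit Arguments.
Unset Strict Implicit.
Unset Printing Implicit Defensive.
Import Order.TTheory GRing.Theory Num.Theory.
Import numFieldNormedType.Exports.
Local Open Scope classical_set_scope.
Local Open Scope ring_scope.

(* Indices 1, ..., n+1 are shifted to 0, ..., n, i.e. to 'I_n.+1. *)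

Definition ninv (m : nat) (s : 'S_m) : nat :=
  #|[pred p : 'I_m * 'I_m | (p.1 < p.2)%N && (s p.2 < s p.1)%N]|.

Definition eta_perm (m : nat) : 'S_m := perm (@rev_ord_inj m).

Definition frak_a (R : realType) (n : nat) (j : 'I_n) : 'M[R]_n.+1 :=
  delta_mx (lift ord0 j) (widen_ord (leqnSn n) j)
  - delta_mx (widen_ord (leqnSn n) j) (lift ord0 j).

Definition SO (R : realType) (m : nat) : set 'M[R]_m :=
  [set A | A *m A^T = 1%:M /\ \det A = 1].

Definition tangent_SO (R : realType) (m : nat) (A : 'M[R]_m) : set 'M[R]_m :=
  [set Y | (A^T *m Y)^T = - (A^T *m Y)].

Definition Up_plus (R : realType) (m : nat) : set 'M[R]_m :=
  [set A | (forall i j : 'I_m, (j < i)%N -> A i j = 0) /\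
           (forall i, 0 < A i i)].

(* [signed_perm s P]: e_j^T P = +/- e_{j^s}^T for all j; this determines s. *)
Definition signed_perm (R : realType) (m : nat) (s : 'S_m) (P : 'M[R]_m) :=
  forall j : 'I_m, row j P = delta_mx 0 (s j) \/ row j P = - delta_mx 0 (s j).

Definition B_plus (R : realType) (m : nat) : set 'M[R]_m :=
  [set P | (exists s : 'S_m, signed_perm s P) /\ \det P = 1].

Arguments SO : clear implicits.
Arguments Up_plus : clear implicits.
Arguments B_plus : clear implicits.

HB.mixin Record isTopGroup G of Group G & Topological G := {
  mulg_continuous : continuous (fun x : G * G => (x.1 * x.2)%g) ;
  invg_continuous : continuous (fun x : G => (x^-1)%g)
}.

#[short(type="topGroupType")]
HB.structure Definition TopGroup :=
  {G of Group G & Topological G & isTopGroup G}.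

Definition homeo_on (X Y : topologicalType) (A : set X) (B : set Y)
    (p : X -> Y) : Prop :=
  [/\ {within A, continuous p}, (forall x, A x -> B (p x)) &
      exists s : Y -> X,
        [/\ {within B, continuous s}, (forall y, B y -> A (s y)),
            (forall x, A x -> s (p x) = x) & (forall y, B y -> p (s y) = y)]].

Definition double_covering (X Y : topologicalType) (B : set Y) (p : X -> Y) :=
  [/\ continuous p, (forall x, B (p x)) &
      forall y, B y -> exists (W : set Y) (V : bool -> set X),
        [/\ open W /\ W y, (forall b, open (V b)),
            V true `&` V false = set0, p @^-1` W = V true `|` V false &
            forall b, homeo_on (V b) (W `&` B) p]].

Definition simply_connected (R : realType) (X : topologicalType) : Prop :=
  (forall x y : X, exists c : R -> X,
     [/\ {within `[0, 1], continuous c}, c 0 = x & c 1 = y]) /\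
  (forall c : R -> X, {within `[0, 1], continuous c} -> c 0 = c 1 ->
     exists H : R * R -> X,
       [/\ {within `[0, 1] `*` `[0, 1], continuous H},
           (forall t, t \in `[0, 1] -> H (0, t) = c t),
           (forall t, t \in `[0, 1] -> H (1, t) = c 0) &
           (forall s, s \in `[0, 1] -> H (s, 0) = c 0 /\ H (s, 1) = c 0)]).

(* The group Spin_{n+1} (n >= 2) is characterized, up to unique isomorphism
   over SO_{n+1}, as a simply connected topological group with a two-sheeted
   covering homomorphism onto SO_{n+1}. *)
Definition spin_covering (R : realType) (n : nat) (G : topGroupType)
    (Pi : G -> 'M[R]_n.+1) : Prop :=
  [/\ forall x y : G, Pi (x * y)%g = Pi x *m Pi y,
      double_covering (SO R n.+1) Pi &
      simply_connected R G].

Definition B_tilde (R : realType) (n : nat) (G : topGroupType)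
    (Pi : G -> 'M[R]_n.+1) : set G := Pi @^-1` B_plus R n.+1.

Definition Bru (R : realType) (n : nat) (G : topGroupType)
    (Pi : G -> 'M[R]_n.+1) (z : G) : set G :=
  connected_component
    (Pi @^-1` ([set L *m Pi z *m M | L in Up_plus R n.+1 & M in Up_plus R n.+1]
               `&` SO R n.+1)) z.

(* C^k on an open set A; in finite dimension, continuity of x |-> 'd f x is
   equivalent to continuity of x |-> 'd f x v for each fixed v. *)
Fixpoint Ck (R : realType) (V W : normedModType R) (k : nat) (A : set V)
    (f : V -> W) : Prop :=
  if k is k'.+1 then
    (forall x, A x -> differentiable f x) /\
    (forall v : V, Ck k' A (fun x => 'd f x v))
  else forall x, A x -> {for x, continuous f}.

Definition smooth (R : realType) (V W : normedModType R) (A : set V)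
    (f : V -> W) : Prop := forall k, Ck k A f.

(* The smooth structure of Spin is the one making Pi a local diffeomorphism
   onto the submanifold SO of the space of matrices: F is smooth when it is
   locally g \o Pi for a smooth function g of matrices. *)
Definition smooth_on_spin (R : realType) (n : nat) (G : topGroupType)
    (Pi : G -> 'M[R]_n.+1) (U : set G) (F : G -> R) : Prop :=
  forall z, U z -> exists (W : set 'M[R]_n.+1) (g : 'M[R]_n.+1 -> R^o),
    [/\ open W, W (Pi z), smooth W g & \forall w \near z, F w = g (Pi w)].

(* The derivative of F at z in the direction of the tangent vector of Spin
   whose image under the differential of Pi is Y is equal to r. For Y tangent
   to SO at Pi z this does not depend on the local extension g. *)
Definition is_dspin (R : realType) (n : nat) (G : topGroupType)
    (Pi : G -> 'M[R]_n.+1) (F : G -> R) (z : G) (Y : 'M[R]_n.+1) (r : R) :=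
  exists g : 'M[R]_n.+1 -> R^o,
    [/\ differentiable g (Pi z), \forall w \near z, F w = g (Pi w) &
        'd g (Pi z) Y = r].

Definition dspin_surjective (R : realType) (n : nat) (G : topGroupType)
    (Pi : G -> 'M[R]_n.+1) (k : nat) (f : G -> 'rV[R]_k) (z : G) : Prop :=
  forall y : 'rV[R]_k, exists2 Y, tangent_SO (Pi z) Y &
    forall i, is_dspin Pi (fun w => f w 0 i) z Y (y 0 i).

Definition abs_continuous (R : realType) (V : normedModType R) (a b : R)
    (u : R -> V) : Prop :=
  forall e : R, 0 < e -> exists2 d : R, 0 < d &
    forall (m : nat) (x y : 'I_m -> R),
      (forall i, a <= x i /\ x i <= y i /\ y i <= b) ->
      (forall i j : 'I_m, (i < j)%N -> y i <= x j) ->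
      \sum_i (y i - x i) < d -> \sum_i `|u (y i) - u (x i)| < e.

(* Since Pi is a local diffeomorphism, regularity of a curve in Spin amounts to
   continuity together with the regularity of its projection, and its
   logarithmic derivative is that of its projection. Absolute continuity on an
   open interval means absolute continuity on each compact subinterval. *)
Definition locally_convex_curve (R : realType) (n : nat) (G : topGroupType)
    (Pi : G -> 'M[R]_n.+1) (a b : R) (c : R -> G) : Prop :=
  [/\ {within `]a, b[, continuous c},
      forall s t : R, a < s -> s <= t -> t < b -> abs_continuous s t (Pi \o c) &
      forall t, t \in `]a, b[ -> derivable (Pi \o c) t 1 ->
        exists2 kappa : 'I_n -> R, (forall j, 0 < kappa j) &
          invmx (Pi (c t)) *m derive1 (Pi \o c) t
          = \sum_(j < n) kappa j *: frak_a R j].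

Definition smooth_curve (R : realType) (n : nat) (G : topGroupType)
    (Pi : G -> 'M[R]_n.+1) (a b : R) (c : R -> G) : Prop :=
  {within `]a, b[, continuous c} /\
  smooth (V := R^o) [set` `]a, b[] (Pi \o c).

(* Main.v *)
Require Import Defs.
From HB Require Import structures.
From mathcomp Require Import all_boot all_order all_algebra perm.
From mathcomp Require Import all_classical all_reals all_analysis.
From mathcomp Require Import ring zify.
Set Implicit Arguments.
Unset Strict Implicit.
Unset Printing Implicit Defensive.
Import Order.TTheory GRing.Theory Num.Theory.
Import numFieldNormedType.Exports.
Local Open Scope classical_set_scope.
Local Open Scope ring_scope.

(** Write P for the image of z0, and on the open set of matrices Q whose
    product P^T Q has a factorization L T, with L unipotent lower triangular
    and T upper triangular with positive diagonal, regard the entries of L as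
    functions of Q.

    The double coset Up P Up consists of the Q = P L T for which P L P^T is
    upper triangular.  Conjugation by P permutes the positions, so this says
    that L vanishes at the positions (sigma j, sigma i) for all i < j with
    sigma i < sigma j ([cellP]).  There are inv(eta) - inv(sigma) such pairs,
    and the corresponding entries of L are the components of f.

    Moving Q to Q (1 + h Z) changes L, to first order, by L times the strictly
    lower part of T Z T^-1 ([chart_diff]).  Every strictly lower triangular
    variation of L comes from an antisymmetric Z, hence the surjectivity of
    the differential of f ([chart_diff_surjective]).  When Z is a positive
    combination of the frak_a_j, the strictly lower part of T Z T^-1 lives on
    the subdiagonal and is positive there, so every subdiagonal entry of L
    increases along locally convex curves ([chart_diff_convex]).  As sigma is
    not eta, some subdiagonal position is among those that define the cell
    ([exists_ascent]); it is taken as the last one.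

    The factorization is produced by Gaussian elimination.  Its entries are
    rational functions, smooth where the pivots are positive
    ([gauss_smooth]), and elimination preserves any triangular shape relative
    to a partial order ([gauss_support]); applied to the order transported by
    sigma, this shows that the whole double coset lies in the domain of L.

    What remains is topological: Bru is a single component of the preimage of
    the cell, which may have another one.  A point of the cell is joined to P
    by the straight segment of the unipotent factors, made orthogonal by
    Gram-Schmidt ([cell_path]); lifting connectedness along this path through
    the covering shows that Bru meets every fibre over the cell
    ([path_component]).  The rest of the preimage is thus contained in a
    translate of Bru by an element of the kernel, a connected set, and no
    point of Bru adheres to it ([component_closure_compl]).  Removing its
    closure from the preimage of the domain of L gives the neighborhood. *)

(** * Triangular matrices and Gaussian elimination *)

Definition Lo1 (R : realType) (m : nat) : set 'M[R]_m :=
  [set A | (forall i j : 'I_m, (i < j)%N -> A i j = 0) /\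
           (forall i, A i i = 1)].
Arguments Lo1 : clear implicits.

Definition upper_mx (R : realType) (m : nat) (A : 'M[R]_m) : Prop :=
  forall i j : 'I_m, (j < i)%N -> A i j = 0.

Lemma upper_mulmx (R : realType) (m : nat) (A B : 'M[R]_m) :
  upper_mx A -> upper_mx B -> upper_mx (A *m B).
Proof.
move=> hA hB i j ji; rewrite mxE big1 // => c _.
have [ci|ic] := ltnP c i; first by rewrite hA ?mul0r.
by rewrite hB ?mulr0 // (leq_trans ji).
Qed.

Lemma upper_mulmx_diag (R : realType) (m : nat) (A B : 'M[R]_m) i :
  upper_mx A -> upper_mx B -> (A *m B) i i = A i i * B i i.
Proof.
move=> hA hB; rewrite mxE (bigD1 i) //= big1 ?addr0 // => c ci.
have [ltci|leic] := ltnP c i; first by rewrite hA ?mul0r.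
by rewrite hB ?mulr0 // ltn_neqAle leic andbT eq_sym.
Qed.

Lemma Up_plus_mul (R : realType) (m : nat) (A B : 'M[R]_m) :
  Up_plus R m A -> Up_plus R m B -> Up_plus R m (A *m B).
Proof.
move=> [uA dA] [uB dB]; split; first exact: upper_mulmx.
by move=> i; rewrite upper_mulmx_diag // mulr_gt0.
Qed.

Lemma upper_det (R : realType) (m : nat) (A : 'M[R]_m) :
  upper_mx A -> \det A = \prod_i A i i.
Proof.
move=> uA; rewrite -det_tr det_trig; last first.
  by apply/is_trig_mxP => i j ij; rewrite mxE uA.
by apply: eq_bigr => i _; rewrite mxE.
Qed.

Lemma Up_plus_det_gt0 (R : realType) (m : nat) (A : 'M[R]_m) :
  Up_plus R m A -> 0 < \det A.
Proof. by move=> [uA dA]; rewrite upper_det // prodr_gt0. Qed.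

Lemma Up_plus_unit (R : realType) (m : nat) (A : 'M[R]_m) :
  Up_plus R m A -> A \in unitmx.
Proof. by move=> hA; rewrite unitmxE unitfE gt_eqF // Up_plus_det_gt0. Qed.

Lemma Lo1_det (R : realType) (m : nat) (A : 'M[R]_m) :
  Lo1 R m A -> \det A = 1.
Proof.
move=> [lA dA]; rewrite det_trig; last by apply/is_trig_mxP.
by rewrite big1.
Qed.

Lemma Lo1_unit (R : realType) (m : nat) (A : 'M[R]_m) :
  Lo1 R m A -> A \in unitmx.
Proof. by move=> hA; rewrite unitmxE Lo1_det // unitr1. Qed.

Section Gauss.
Variables (R : realType) (n : nat).
Implicit Types M L T : 'M[R]_n.+1.

(** The Schur complements of Gaussian elimination, with their size kept
    constant: at step b, the rank one matrix that agrees with the current one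
    on row b and on column b is subtracted. *)
Fixpoint gauss (b : nat) M : 'M[R]_n.+1 :=
  if b is c.+1 then
    let N := gauss c M in let p := inord c in
    \matrix_(i, j) (N i j - N i p * N p j / N p p)
  else M.

Lemma gaussS (b : 'I_n.+1) M i j :
  gauss b.+1 M i j = gauss b M i j - gauss b M i b * gauss b M b j / gauss b M b b.
Proof. by rewrite /= mxE inord_val. Qed.

Definition pivots_pos M := forall b : 'I_n.+1, 0 < gauss b M b b.

Definition gaussL M : 'M[R]_n.+1 := \matrix_(a, b) (gauss b M a b / gauss b M b b).
Definition gaussU M : 'M[R]_n.+1 := \matrix_(b, j) gauss b M b j.

Lemma gauss_zero M (b : nat) (i j : 'I_n.+1) : pivots_pos M ->
  (b <= n.+1)%N -> (i < b)%N || (j < b)%N -> gauss b M i j = 0.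
Proof.
move=> piv; elim: b i j => [|b IH] i j // bn ijb.
rewrite (gaussS (Ordinal bn)) /=.
set p := Ordinal bn; have pp : gauss b M p p != 0 by rewrite gt_eqF // (piv p).
have IH' := fun i j => IH i j (ltnW bn).
have [ib|ib] := ltnP i b.
  by rewrite !(IH' i) ?ib // !mul0r subr0.
have [jb|jb] := ltnP j b.
  by rewrite !(IH' _ j) ?jb ?orbT // !(mulr0, mul0r) subr0.
case/orP: ijb => h.
  have -> : i = p by apply/val_inj => /=; lia.
  by rewrite mulrAC divff // mul1r subrr.
have -> : j = p by apply/val_inj => /=; lia.
by rewrite mulfK // subrr.
Qed.

(** Each step subtracts the product of column b of [gaussL M] and row b of
    [gaussU M], so that the matrix is the sum of what has been removed and
    what is left. *)
Lemma gauss_telescope M (b : nat) (i j : 'I_n.+1) : (b <= n.+1)%N ->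
  M i j = \sum_(c < n.+1 | (c < b)%N) gaussL M i c * gaussU M c j + gauss b M i j.
Proof.
elim: b => [|b IH] bn; first by rewrite big1 ?add0r // => c; rewrite ltn0.
rewrite (gaussS (Ordinal bn)) [LHS]IH 1?ltnW //.
rewrite [in RHS](bigD1 (Ordinal bn)) //=.
rewrite [in RHS](eq_bigl (fun c : 'I_n.+1 => (c < b)%N)); last first.
  by move=> c; rewrite ltnS -val_eqE /= ltn_neqAle andbC.
rewrite !mxE /=; ring.
Qed.

Lemma gauss_LU M : pivots_pos M -> M = gaussL M *m gaussU M.
Proof.
move=> piv; apply/matrixP => i j; rewrite mxE (@gauss_telescope M n.+1) //.
rewrite gauss_zero ?ltn_ord // addr0; apply: eq_bigl => c; exact: ltn_ord.
Qed.

Lemma gaussL_Lo1 M : pivots_pos M -> Lo1 R n.+1 (gaussL M).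
Proof.
move=> piv; split=> [i j ij|i]; rewrite mxE; last by rewrite divff // gt_eqF.
by rewrite gauss_zero ?ij // ?mul0r // ltnW.
Qed.

Lemma gaussU_Up M : pivots_pos M -> Up_plus R n.+1 (gaussU M).
Proof.
move=> piv; split=> [i j ij|i]; rewrite mxE //.
by rewrite gauss_zero ?ij ?orbT // ltnW.
Qed.

(** On a product L T, elimination strips the rank one terms of the product one
    by one, whence the uniqueness of the factorization below. *)
Lemma gauss_of_LU L T (b : nat) (i j : 'I_n.+1) : Lo1 R n.+1 L -> upper_mx T ->
  (forall c, T c c != 0) -> (b <= n.+1)%N ->
  gauss b (L *m T) i j = \sum_(c < n.+1 | (b <= c)%N) L i c * T c j.
Proof.
move=> [lL dL] uT dT; elim: b i j => [|b IH] i j bn; first by rewrite mxE.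
rewrite (gaussS (Ordinal bn)) /= !IH 1?ltnW //; set p := Ordinal bn.
have rowp k : \sum_(c < n.+1 | (b <= c)%N) L p c * T c k = T p k.
  rewrite (bigD1 p) //= dL mul1r big1 ?addr0 // => c /andP[bc cp].
  by rewrite lL ?mul0r //= ltn_neqAle bc andbT eq_sym.
have -> : \sum_(c < n.+1 | (b <= c)%N) L i c * T c p = L i p * T p p.
  rewrite (bigD1 p) //= big1 ?addr0 // => c /andP[bc cp].
  by rewrite uT ?mulr0 //= ltn_neqAle bc andbT eq_sym.
rewrite !rowp (bigD1 p) //=.
have -> : L i p * T p p * T p j / T p p = L i p * T p j by field.
rewrite addrAC subrr add0r; apply: eq_bigl => c.
by rewrite -val_eqE /= [RHS]ltn_neqAle eq_sym andbC.
Qed.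

Lemma gaussL_unique L T : Lo1 R n.+1 L -> upper_mx T ->
  (forall c, T c c != 0) -> gaussL (L *m T) = L.
Proof.
move=> hL uT dT; apply/matrixP => a b; rewrite mxE !gauss_of_LU // 1?ltnW //.
have colb k : \sum_(c < n.+1 | (b <= c)%N) L k c * T c b = L k b * T b b.
  rewrite (bigD1 b) //= big1 ?addr0 // => c /andP[bc cb].
  by rewrite uT ?mulr0 // ltn_neqAle bc andbT eq_sym.
by rewrite !colb hL.2 mul1r mulfK.
Qed.

Lemma pivots_pos_LU L T : Lo1 R n.+1 L -> Up_plus R n.+1 T -> pivots_pos (L *m T).
Proof.
move=> hL [uT dT] b; rewrite gauss_of_LU //; [|by move=> c; rewrite gt_eqF|by rewrite ltnW].
rewrite (bigD1 b) //= hL.2 mul1r big1 ?addr0 // => c /andP[bc cb].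
by rewrite uT ?mulr0 // ltn_neqAle bc andbT eq_sym.
Qed.

(** A correction N_ip N_pj is nonzero only if r i p and r p j, hence only if
    r i j, so that elimination in the order of the indices keeps a matrix
    triangular with respect to an unrelated relation r. *)
Lemma gauss_support (r : rel 'I_n.+1) M (b : nat) (i j : 'I_n.+1) :
  transitive r -> (forall i j, ~~ r i j -> M i j = 0) -> ~~ r i j -> gauss b M i j = 0.
Proof.
move=> tr hM; elim: b i j => [|b IH] i j rij /=; first exact: hM.
rewrite mxE IH // sub0r.
have [rip|/IH ->] := boolP (r i (inord b)); last by rewrite !mul0r oppr0.
have [rpj|/IH ->] := boolP (r (inord b) j); last by rewrite mulr0 mul0r oppr0.
by rewrite (tr _ _ _ rip rpj) in rij.
Qed.

(** The correction N_ip N_pi of a diagonal entry would need both r i p and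
    r p i.  The pivots are therefore the diagonal entries of M. *)
Lemma gauss_support_diag (r : rel 'I_n.+1) M (b : nat) (i : 'I_n.+1) :
  transitive r -> antisymmetric r ->
  (forall i j, ~~ r i j -> M i j = 0) -> (b <= i)%N -> gauss b M i i = M i i.
Proof.
move=> tr asym hM; elim: b => [|b IH] bi //=.
rewrite mxE IH 1?ltnW //.
have [rip|/(gauss_support b tr hM) ->] := boolP (r i (inord b)); last by rewrite !mul0r subr0.
have [rpi|/(gauss_support b tr hM) ->] := boolP (r (inord b) i); last first.
  by rewrite mulr0 mul0r subr0.
have e : i = inord b by apply: asym; rewrite rip rpi.
have bn : (b < n.+1)%N := ltn_trans bi (ltn_ord i).
by move: bi; rewrite e inordK // ltnn.
Qed.

Lemma gauss_sym M (b : nat) : M^T = M -> (gauss b M)^T = gauss b M.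
Proof.
move=> sM; elim: b => [|b IH] //=; apply/matrixP => i j; rewrite !mxE.
have s k l : gauss b M k l = gauss b M l k by rewrite -[in LHS]IH mxE.
by rewrite (s j i) [gauss b M j _]s [gauss b M _ i]s (mulrC (gauss b M _ j)).
Qed.

Definition qform M (x : 'cV[R]_n.+1) : R := (x^T *m M *m x) 0 0.

(** Completing the square: the quadratic form of [gauss b M], taken at its
    critical point in the b-th coordinate, is that of [gauss b.+1 M]. *)
Lemma gauss_qform M (b : nat) (x : 'cV[R]_n.+1) : M^T = M -> (b <= n.+1)%N ->
  (forall c : 'I_n.+1, (c < b)%N -> gauss c M c c != 0) ->
  exists2 y : 'cV[R]_n.+1, (forall c : 'I_n.+1, (b <= c)%N -> y c 0 = x c 0) &
    qform (gauss b M) x = qform M y.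
Proof.
move=> sM; elim: b x => [|b IH] x bn piv; first by exists x.
set p := Ordinal bn; set N := gauss b M.
have sN : N^T = N by exact: gauss_sym.
(* t is the critical point of the quadratic form of N on x + t e_p *)
pose t : R := - (N *m x) p 0 / N p p.
have [|y yx qy] := IH (x + t *: delta_mx p 0) (ltnW bn).
  by move=> c cb; apply: piv; rewrite ltnS ltnW.
exists y.
  move=> c bc; rewrite yx 1?ltnW // !mxE.
  have -> : (c == p) = false by apply/negbTE; rewrite -val_eqE /= gtn_eqF.
  by rewrite mulr0 addr0.
rewrite -qy /qform.
have Np : N p p != 0 by apply: (piv p) => /=.
have -> : gauss b.+1 M = N - (N p p)^-1 *: (col p N *m row p N).
  apply/matrixP => i j; rewrite (gaussS p) /= -/N !mxE big_ord1 !mxE; ring.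
set s := (N *m x) p 0.
have e1 : (row p N *m x) = s%:M.
  by rewrite -row_mul; apply/matrixP => i j; rewrite [i]ord1 [j]ord1 [RHS]mxE eqxx mulr1n mxE.
have e2 : (x^T *m col p N) = s%:M.
  by rewrite -[LHS]trmxK trmx_mul trmxK tr_col sN e1 tr_scalar_mx.
have -> : (x + t *: delta_mx p 0)^T = x^T + t *: delta_mx 0 p.
  by apply/matrixP => i j; rewrite !mxE andbC.
have E1 : x^T *m (col p N *m row p N) *m x = (s * s)%:M.
  by rewrite mulmxA -mulmxA e1 e2 -scalar_mxM.
have E2 : (delta_mx 0 p : 'rV[R]_n.+1) *m N *m x = s%:M by rewrite -rowE.
have E3 : x^T *m N *m delta_mx p 0 = s%:M by rewrite -mulmxA -colE.
have E4 : (delta_mx 0 p : 'rV[R]_n.+1) *m N *m delta_mx p 0 = (N p p)%:M.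
  by rewrite -rowE -colE; apply/matrixP => i j; rewrite !mxE ord1 [j]ord1.
rewrite mulmxBr mulmxBl -scalemxAr -scalemxAl E1.
rewrite !(mulmxDl, mulmxDr). rewrite -!scalemxAl -!scalemxAr -/N E2 E3 E4.
rewrite !mxE eqxx !mulr1n /t -/s.
by field.
Qed.
End Gauss.

(** * Calculus of functions of class C^k *)

Section CkCalculus.
Variables (R : realType) (V : normedModType R).
Implicit Types (f g : V -> R^o) (A B : set V).

Lemma Ck_sub (W : normedModType R) k A B (f : V -> W) :
  B `<=` A -> Ck k A f -> Ck k B f.
Proof.
move=> BA; elim: k f => [|k IH] f /=; first by move=> h x /BA; exact: h.
by move=> [df dk]; split=> [x /BA|v]; [exact: df|exact/IH/dk].
Qed.

Lemma Ck_pred (W : normedModType R) k A (f : V -> W) :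
  Ck k.+1 A f -> Ck k A f.
Proof.
elim: k f => [|k IH] f /= [df dk].
  by move=> x Ax; apply: differentiable_continuous; exact: df.
by split=> // v; exact/IH/dk.
Qed.

Lemma Ck_cst k A (c : R^o) : Ck k A (cst c : V -> R^o).
Proof.
elim: k c => [|k IH] c /=; first by move=> x _; exact: cst_continuous.
split=> [x _|v]; first exact: differentiable_cst.
have -> : (fun x => 'd (cst c : V -> R^o) x v) = cst 0.
  by apply/funext => x; rewrite diff_cst.
exact: IH.
Qed.

Lemma Ck_linear k A (f : {linear V -> R^o}) : continuous f -> Ck k A f.
Proof.
move=> cf; case: k => [|k] /=; first by move=> x _; exact: cf.
split=> [x _|v]; first exact: linear_differentiable.
have -> : (fun x => 'd f x v) = cst (f v).
  by apply/funext => x; rewrite diff_lin.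
exact: Ck_cst.
Qed.

(** The differential is chosen by a description operator, so even its
    locality has to be derived from the uniqueness of differentials. *)
Lemma differentiable_near0 f x : (\forall y \near x, f y = 0) ->
  differentiable f x.
Proof.
move=> f0.
have fo : f \o shift x = cst (f x) + (\0 : V -> R^o) +o_ 0 id.
  apply/eqaddoP => _ /posnumP[e].
  have : \forall h \near (0 : V), f (h + x) = 0.
    by rewrite -(add0r x) in f0; rewrite (near_shift x) sub0r; near=> y => /=;
    rewrite addrNK; near: y; move: f0; rewrite add0r.
  apply: filterS => h fh /=.
  by rewrite /= !fctE /= fh (nbhs_singleton f0) addr0 subrr normr0 mulr_ge0.
apply/diff_locallyP.
have c0 : continuous (\0 : {linear V -> R^o}) by move=> ?; exact: cst_continuous.
by rewrite (diff_unique c0 fo).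
Unshelve. all: by end_near. Qed.

Lemma near_eq_differentiable f g x : (\forall y \near x, f y = g y) ->
  differentiable f x -> differentiable g x /\ 'd g x = 'd f x :> (V -> R^o).
Proof.
move=> fg df.
have dg : differentiable g x.
  have -> : g = f + (g - f) by apply/funext => y; rewrite !fctE /= addrC subrK.
  apply: (differentiableD df); apply: differentiable_near0.
  by near=> y; rewrite !fctE /=; rewrite (near fg y) // subrr.
split; first exact: dg.
apply/funext => v; rewrite -(deriveE v dg) -(deriveE v df).
by apply: near_eq_derive; near do apply/esym.
Unshelve. all: by end_near. Qed.

(** The rules for the differential of a product or an inverse hold only on A,
    where the factors are differentiable; this lemma lets them be used under
    the induction on k. *)
Lemma Ck_ext k A f g : open A -> (forall x, A x -> f x = g x) ->
  Ck k A f -> Ck k A g.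
Proof.
move=> oA; have near x : A x -> \forall y \near x, A y.
  by move=> Ax; exact: open_nbhs_nbhs.
elim: k f g => [|k IH] f g fg /=.
  move=> cf x Ax; rewrite /prop_for /continuous_at -(fg x Ax).
  apply: cvg_trans (cf x Ax); apply: near_eq_cvg.
  by apply: filterS (near _ Ax).
move=> [df dk].
have dfg x : A x -> differentiable g x /\ 'd g x = 'd f x :> (V -> R^o).
  by move=> Ax; apply: near_eq_differentiable (df x Ax); apply: filterS (near _ Ax).
split=> [x /dfg[]//|v]; apply: IH (dk v) => x Ax.
exact: esym (congr1 (fun h : V -> R^o => h v) (dfg x Ax).2).
Qed.

Lemma CkD k A f g : open A -> Ck k A f -> Ck k A g -> Ck k A (fun x => f x + g x).
Proof.
move=> oA; elim: k f g => [|k IH] f g /=.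
  by move=> cf cg x Ax; apply: continuousD; [exact: cf|exact: cg].
move=> [df dkf] [dg dkg]; split=> [x Ax|v].
  by apply: (@differentiableD _ _ _ f g); [exact: df|exact: dg].
apply: (Ck_ext oA _ (IH _ _ (dkf v) (dkg v))) => x Ax.
exact: esym (congr1 (fun h : V -> R^o => h v) (diffD (df x Ax) (dg x Ax))).
Qed.

Lemma CkM k A f g : open A -> Ck k A f -> Ck k A g ->
  Ck k A (fun x => f x * g x : R^o).
Proof.
move=> oA; elim: k f g => [|k IH] f g.
  by move=> cf cg x Ax; apply: continuousM; [exact: cf|exact: cg].
move=> ckf ckg; have kf := Ck_pred ckf; have kg := Ck_pred ckg.
case: ckf ckg => [df dkf] [dg dkg]; split=> [x Ax|v].
  by apply: (@differentiableM _ _ f g); [exact: df|exact: dg].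
apply: (Ck_ext oA _ (CkD oA (IH _ _ kf (dkg v)) (IH _ _ kg (dkf v)))) => x Ax.
exact: esym (congr1 (fun h : V -> R^o => h v) (diffM (df x Ax) (dg x Ax))).
Qed.

Lemma CkN k A f : open A -> Ck k A f -> Ck k A (fun x => - f x).
Proof.
move=> oA cf; have := CkM oA (Ck_cst k A (-1)) cf.
by apply: Ck_ext => // x _; rewrite mulN1r.
Qed.

Lemma CkV k A f : open A -> (forall x, A x -> f x != 0) -> Ck k A f ->
  Ck k A (fun x => (f x)^-1 : R^o).
Proof.
move=> oA f0; elim: k => [|k IH].
  by move=> cf x Ax; apply: continuousV; [exact: f0|exact: cf].
move=> ckf; have kV := IH (Ck_pred ckf).
case: ckf => [df dkf]; split=> [x Ax|v].
  by apply: (@differentiableV _ _ f); [exact: df|exact: f0].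
apply: (Ck_ext oA _ (CkN oA (CkM oA (CkM oA kV kV) (dkf v)))) => x Ax.
have e := congr1 (fun h : V -> R => h v) (diffV (df x Ax) (f0 x Ax)).
by apply: etrans (esym e); rewrite /= expr2 invfM scaleNr.
Qed.

Lemma Ck_sum k A (I : Type) (r : seq I) (P : pred I) (F : I -> V -> R^o) :
  open A -> (forall i, P i -> Ck k A (F i)) ->
  Ck k A (fun x => \sum_(i <- r | P i) F i x).
Proof.
move=> oA hF; elim: r => [|i r IH].
  by apply: (Ck_ext oA _ (Ck_cst k A 0)) => x _; rewrite big_nil.
have [Pi|nPi] := boolP (P i).
  by apply: (Ck_ext oA _ (CkD oA (hF i Pi) IH)) => x _; rewrite big_cons Pi.
by apply: (Ck_ext oA _ IH) => x _; rewrite big_cons (negbTE nPi).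
Qed.

End CkCalculus.

(** * Smoothness of the triangular factorization *)

Section GaussSmooth.
Variables (R : realType) (n : nat).

Lemma Ck_coord k (m p : nat) (A : set 'M[R]_(m.+1, p.+1)) i j :
  Ck k A (fun Q : 'M[R]_(m.+1, p.+1) => Q i j : R^o).
Proof.
have @f : {linear 'M[R]_(m.+1, p.+1) -> R^o}.
  by exists (fun N : 'M[R]_(_, _) => N i j); do 2![eexists]; do ?[constructor];
     rewrite ?mxE// => ? *; rewrite ?mxE//; move=> ?; rewrite !mxE.
by apply: (@Ck_linear _ _ k A f) => x; exact: coord_continuous.
Qed.

Variable P : 'M[R]_n.+1.

Definition pivot_dom (b : nat) : set 'M[R]_n.+1 :=
  [set Q | forall c : 'I_n.+1, (c < b)%N -> 0 < gauss c (P *m Q) c c].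

Lemma pivot_dom_sub (b c : nat) : (b <= c)%N -> pivot_dom c `<=` pivot_dom b.
Proof. by move=> bc Q hQ d db; apply: hQ; exact: leq_trans bc. Qed.

(** Openness and smoothness are proved together: the condition on the next
    pivot is open because this pivot is continuous on the previous domain, and
    the next step divides by it. *)
Lemma gauss_smooth (b : nat) : (b <= n.+1)%N -> open (pivot_dom b) /\
  forall k i j, Ck k (pivot_dom b) (fun Q => gauss b (P *m Q) i j : R^o).
Proof.
elim: b => [_|b IH bn].
  have -> : pivot_dom 0 = setT by apply/seteqP; split=> // Q _ c; rewrite ltn0.
  split=> [|k i j]; first exact: openT.
  apply: (@Ck_ext _ _ k _ (fun Q : 'M[R]_n.+1 => \sum_l P i l * Q l j : R^o)) => //.
  - exact: openT.
  - by move=> Q _ /=; rewrite mxE.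
  by apply: Ck_sum => [|l _]; [exact: openT|]; apply: CkM;
    [exact: openT|exact: Ck_cst|exact: Ck_coord].
have [oD cD] := IH (ltnW bn); set p := Ordinal bn.
have DE : pivot_dom b.+1 =
    pivot_dom b `&` [set Q | 0 < gauss b (P *m Q) p p].
  apply/seteqP; split=> [Q hQ|Q [hQ Qp] c].
    by split; [exact: pivot_dom_sub hQ|exact: (hQ p)].
  rewrite ltnS leq_eqVlt => /orP[/eqP cb|/hQ//].
  by have -> : c = p by exact: val_inj.
have oD' : open (pivot_dom b.+1).
  rewrite DE openE => Q [hQ Qp]; apply: filterI.
    exact: open_nbhs_nbhs.
  apply: (cD 0%N p p Q hQ [set x : R^o | 0 < x]).
  by apply: open_nbhs_nbhs; split => //; exact: open_gt.
split=> // k i j.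
have cD' i' j' : Ck k (pivot_dom b.+1) (fun Q => gauss b (P *m Q) i' j' : R^o).
  exact: Ck_sub (pivot_dom_sub (leqnSn b)) (cD k i' j').
apply: (Ck_ext (f := fun Q : 'M[R]_n.+1 => gauss b (P *m Q) i j +
  - (gauss b (P *m Q) i p * gauss b (P *m Q) p j * (gauss b (P *m Q) p p)^-1) : R^o)) => //.
  by move=> Q _; rewrite (gaussS p).
apply: CkD => //; apply: CkN => //; apply: CkM => //; first exact: CkM.
by apply: CkV => // Q hQ; rewrite gt_eqF //; exact: (hQ p).
Qed.

Lemma pivots_posE : [set Q | pivots_pos (P *m Q)] = pivot_dom n.+1.
Proof. by apply/seteqP; split=> Q hQ c; [move=> _|]; exact: hQ. Qed.

Lemma open_pivots_pos : open [set Q | pivots_pos (P *m Q)].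
Proof. by rewrite pivots_posE; case: (gauss_smooth (leqnn n.+1)). Qed.

Lemma gauss_smooth_pivots_pos k (b : 'I_n.+1) i j :
  Ck k [set Q | pivots_pos (P *m Q)] (fun Q => gauss b (P *m Q) i j : R^o).
Proof.
have bn : (b <= n.+1)%N by rewrite ltnW.
rewrite pivots_posE; apply: Ck_sub (pivot_dom_sub bn) _.
exact: (gauss_smooth bn).2.
Qed.

Lemma gaussL_smooth i j :
  smooth [set Q | pivots_pos (P *m Q)] (fun Q => gaussL (P *m Q) i j : R^o).
Proof.
move=> k; have oA := open_pivots_pos; have cG := @gauss_smooth_pivots_pos k j.
apply: (Ck_ext (f := fun Q : 'M[R]_n.+1 =>
  gauss j (P *m Q) i j * (gauss j (P *m Q) j j)^-1 : R^o)) => //.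
  by move=> Q _; rewrite mxE.
by apply: CkM => //; apply: CkV => // Q hQ; rewrite gt_eqF //; exact: hQ.
Qed.

End GaussSmooth.

(** * Continuity of matrix-valued functions *)

Section Continuity.
Variables (R : realType) (T : topologicalType).

Lemma continuous_at_ext (Y : topologicalType) (f g : T -> Y) x :
  f =1 g -> {for x, continuous f} -> {for x, continuous g}.
Proof. by move=> /funext ->. Qed.

Lemma continuous_at_mx (m p : nat) (F : T -> 'M[R]_(m, p)) (x : T) :
  (forall i j, {for x, continuous (fun t => F t i j)}) -> {for x, continuous F}.
Proof.
move=> cF A [B hB BA]; rewrite /nbhs /=.
have : \forall t \near x, forall i j, B i j (F t i j).
  apply: filter_forall => i; apply: filter_forall => j; exact: cF i j _ (hB i j).
by apply: filterS => t ht; apply: BA.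
Qed.

Lemma continuous_at_entry (m p : nat) (F : T -> 'M[R]_(m.+1, p.+1)) (x : T) i j :
  {for x, continuous F} -> {for x, continuous (fun t => F t i j)}.
Proof.
move=> cF; apply: (@continuous_comp _ _ _ F (fun M => M i j)) => //.
exact: coord_continuous.
Qed.

Lemma continuous_sumr (I : Type) (r : seq I) (P : pred I) (F : I -> T -> R) x :
  (forall i, P i -> {for x, continuous (F i)}) ->
  {for x, continuous (fun t => \sum_(i <- r | P i) F i t)}.
Proof.
move=> cF; elim: r => [|i r IH].
  by apply: (@continuous_at_ext _ (cst _)); [move=> t; rewrite big_nil|
    exact: cst_continuous].
have [Pi|nPi] := boolP (P i); last first.
  by apply: continuous_at_ext IH => t; rewrite big_cons (negbTE nPi).
apply: (@continuous_at_ext _ (fun t => F i t + \sum_(i <- r | P i) F i t)).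
  by move=> t; rewrite big_cons Pi.
by apply: (@continuousD _ _ _ (F i)); [exact: cF|exact: IH].
Qed.

Lemma continuous_prodr (I : Type) (r : seq I) (P : pred I) (F : I -> T -> R) x :
  (forall i, P i -> {for x, continuous (F i)}) ->
  {for x, continuous (fun t => \prod_(i <- r | P i) F i t)}.
Proof.
move=> cF; elim: r => [|i r IH].
  by apply: (@continuous_at_ext _ (cst _)); [move=> t; rewrite big_nil|
    exact: cst_continuous].
have [Pi|nPi] := boolP (P i); last first.
  by apply: continuous_at_ext IH => t; rewrite big_cons (negbTE nPi).
apply: (@continuous_at_ext _ (fun t => F i t * \prod_(i <- r | P i) F i t)).
  by move=> t; rewrite big_cons Pi.
by apply: (@continuousM _ _ (F i)); [exact: cF|exact: IH].
Qed.

Lemma continuous_mulmx (m p q : nat) (F : T -> 'M[R]_(m, p)) (G : T -> 'M[R]_(p, q)) x :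
  (forall i j, {for x, continuous (fun t => F t i j)}) ->
  (forall i j, {for x, continuous (fun t => G t i j)}) ->
  forall i j, {for x, continuous (fun t => (F t *m G t) i j)}.
Proof.
move=> cF cG i j.
apply: (@continuous_at_ext _ (fun t => \sum_k F t i k * G t k j)).
  by move=> t; rewrite mxE.
by apply: continuous_sumr => k _; apply: (@continuousM _ _ (fun t => F t i k)).
Qed.

Lemma continuous_det (m : nat) (F : T -> 'M[R]_m) x :
  (forall i j, {for x, continuous (fun t => F t i j)}) ->
  {for x, continuous (fun t => \det (F t))}.
Proof.
move=> cF; rewrite /determinant; apply: continuous_sumr => s _.
apply: (@continuousM _ _ (cst _)); first exact: cst_continuous.
by apply: continuous_prodr => i _; exact: cF.
Qed.

Lemma continuous_invmx (m : nat) (F : T -> 'M[R]_m) x :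
  (forall t, F t \in unitmx) ->
  (forall i j, {for x, continuous (fun t => F t i j)}) ->
  forall i j, {for x, continuous (fun t => invmx (F t) i j)}.
Proof.
move=> uF cF i j.
apply: (@continuous_at_ext _ (fun t => (\det (F t))^-1 *
    ((-1) ^+ (j + i) * \det (row' j (col' i (F t)))))).
  by move=> t; rewrite /invmx uF !mxE.
apply: (@continuousM _ _ (fun t => (\det (F t))^-1)).
  apply: continuousV; first by have := uF x; rewrite unitmxE unitfE.
  exact: continuous_det.
apply: (@continuousM _ _ (cst _)); first exact: cst_continuous.
apply: continuous_det => k l.
by apply: continuous_at_ext (cF (lift j k) (lift i l)) => t; rewrite !mxE.
Qed.

End Continuity.

(** * Gram-Schmidt orthonormalization *)

(** The lowest nonzero entry of column j of the inverse, if it were below the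
    diagonal, would be seen in the product with A. *)
Lemma upper_invmx (R : realType) (m : nat) (A : 'M[R]_m) :
  upper_mx A -> A \in unitmx -> upper_mx (invmx A).
Proof.
move=> uA unA i j; set B := invmx A.
have AB : A *m B = 1%:M by rewrite mulmxV.
have dA k : A k k != 0.
  move: unA; rewrite unitmxE unitfE upper_det // => /prodf_neq0; exact.
have [d] := ubnP (m - i)%N; elim: d i => [|d IH] i //.
move=> id ji; have := congr1 (fun M : 'M[R]_m => M i j) AB.
rewrite !mxE (bigD1 i) //= big1 ?addr0 => [|c ci].
  have -> : (i == j) = false by apply/negbTE; rewrite -val_eqE gtn_eqF.
  by move/eqP; rewrite mulf_eq0 (negbTE (dA i)) => /eqP.
have [ltci|leic] := ltnP c i; first by rewrite uA ?mul0r.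
have ltic : (i < c)%N by rewrite ltn_neqAle leic andbT eq_sym.
rewrite IH ?mulr0 ?(ltn_trans ji) //; move: id (ltn_ord c); lia.
Qed.

Lemma Up_plus_invmx (R : realType) (m : nat) (A : 'M[R]_m) :
  Up_plus R m A -> Up_plus R m (invmx A).
Proof.
move=> hA; have unA := Up_plus_unit hA; have [uA dA] := hA.
have uB := upper_invmx uA unA; split=> // i.
have : 0 < A i i * invmx A i i by rewrite -upper_mulmx_diag // mulmxV // mxE eqxx.
by rewrite pmulr_rgt0.
Qed.

(** The transpose is also the inverse, so it is both lower and upper
    triangular. *)
Lemma Up_plus_orthogonal (R : realType) (m : nat) (A : 'M[R]_m) :
  Up_plus R m A -> A^T *m A = 1%:M -> A = 1%:M.
Proof.
move=> hA AA; have [uA dA] := hA.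
have unA := Up_plus_unit hA.
have trA : A^T = invmx A by rewrite -[LHS]mulmx1 -(mulmxV unA) mulmxA AA mul1mx.
have [uB _] := Up_plus_invmx hA; apply/matrixP => i j; rewrite mxE.
have [ij|ji|/val_inj ->] := ssrnat.ltngtP i j.
- by rewrite -val_eqE ltn_eqF // mulr0n -(uB _ _ ij) -trA mxE.
- by rewrite -val_eqE gtn_eqF // mulr0n uA.
have := upper_mulmx_diag j uB uA; rewrite -trA AA !mxE eqxx -expr2 => /esym/eqP.
by rewrite sqrp_eq1 ?ltW // => /eqP.
Qed.

Section GramSchmidt.
Variables (R : realType) (n : nat).
Implicit Types M : 'M[R]_n.+1.

Lemma qform_gram M (x : 'cV[R]_n.+1) :
  qform (M^T *m M) x = \sum_i (M *m x) i 0 ^+ 2.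
Proof.
rewrite /qform !mulmxA -trmx_mul -mulmxA mxE.
by apply: eq_bigr => i _; rewrite mxE expr2.
Qed.

(** By [gauss_qform] the pivot at b is the squared norm of M y for some y
    with y_b = 1. *)
Lemma pivots_pos_gram M : M \in unitmx -> pivots_pos (M^T *m M).
Proof.
move=> uM b; have [c] := ubnP b; elim: c b => [|c IH] b // bc.
have sS : (M^T *m M)^T = M^T *m M by rewrite trmx_mul trmxK.
have [||y yb] := @gauss_qform _ _ (M^T *m M) b (delta_mx b 0) sS.
- by rewrite ltnW.
- by move=> d db; rewrite gt_eqF // IH // (leq_trans db).
have -> : qform (gauss b (M^T *m M)) (delta_mx b 0) = gauss b (M^T *m M) b b.
  by rewrite /qform trmx_delta -rowE -colE !mxE.
move=> ->; rewrite qform_gram lt0r sumr_ge0 ?andbT => [|i _]; last exact: sqr_ge0.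
apply/negP => /eqP /psumr_eq0P h.
have My0 : M *m y = 0.
  apply/matrixP => i j; rewrite [j]ord1 [RHS]mxE; apply/eqP; rewrite -sqrf_eq0.
  by rewrite h // => k _; exact: sqr_ge0.
have := yb b (leqnn b); rewrite -[y](mulKmx uM) My0 mulmx0 !mxE !eqxx.
by move/eqP; rewrite eq_sym oner_eq0.
Qed.

(** If M^T M = L T then T^T = L D, where D is the diagonal of T, so M T^-1 has
    orthogonal columns, which are normalized by the square root of D. *)
Definition gsU M : 'M[R]_n.+1 :=
  let T := gaussU (M^T *m M) in
  invmx T *m diag_mx (\row_b Num.sqrt (T b b)).

Definition gram_schmidt M := M *m gsU M.

Lemma gsU_Up M : M \in unitmx -> Up_plus R n.+1 (gsU M).
Proof.
move=> uM; have hT := gaussU_Up (pivots_pos_gram uM).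
apply: Up_plus_mul; first exact: Up_plus_invmx.
split=> [i j ij|i]; rewrite !mxE; first by rewrite -val_eqE gtn_eqF.
by rewrite eqxx mulr1n sqrtr_gt0; exact: pivots_pos_gram.
Qed.

Lemma gram_schmidt_orthogonal M : M \in unitmx ->
  (gram_schmidt M)^T *m gram_schmidt M = 1%:M.
Proof.
move=> uM; rewrite /gram_schmidt /gsU; set S := M^T *m M; set T := gaussU S.
have piv : pivots_pos S by exact: pivots_pos_gram.
have uT : T \in unitmx by exact/Up_plus_unit/gaussU_Up.
have uL : gaussL S \in unitmx by exact/Lo1_unit/gaussL_Lo1.
set D := diag_mx _.
have sS : S^T = S by rewrite /S trmx_mul trmxK.
have LDD : gaussL S *m D *m D = T^T.
  apply/matrixP => i j; rewrite !mul_mx_diag !mxE.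
  rewrite -mulrA -expr2 sqr_sqrtr; last exact: ltW (piv j).
  rewrite mulfVK; last by rewrite gt_eqF //; exact: piv.
  by rewrite -[in LHS](gauss_sym j sS) mxE.
have uTt : T^T \in unitmx by rewrite unitmx_tr.
have tD : D^T = D by exact: tr_diag_mx.
have uD : D \in unitmx.
  move: uTt; rewrite -LDD !unitmx_mul; by case/andP.
rewrite !trmx_mul tD trmx_inv -/T.
rewrite -!mulmxA (mulmxA M^T) -/S.
rewrite [X in _ *m (_ *m (X *m _))](gauss_LU piv) -/T.
have -> : gaussL S *m T *m (invmx T *m D) = T^T *m invmx D.
  by rewrite -LDD mulmxK // -mulmxA mulKVmx.
by rewrite mulKmx // mulmxV.
Qed.

Lemma gram_schmidt_unique M T : M \in unitmx -> Up_plus R n.+1 T ->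
  (M *m T)^T *m (M *m T) = 1%:M -> gram_schmidt M = M *m T.
Proof.
move=> uM hT oQ; have uT := Up_plus_unit hT.
pose A := invmx T *m gsU M.
have QA : gram_schmidt M = M *m T *m A by rewrite /A mulmxA mulmxK.
suff -> : gram_schmidt M = M *m T *m 1%:M by rewrite mulmx1.
rewrite QA; congr (_ *m _); apply: Up_plus_orthogonal.
  by apply: Up_plus_mul; [exact: Up_plus_invmx|exact: gsU_Up].
rewrite -(gram_schmidt_orthogonal uM) QA [(_ *m A)^T]trmx_mul -[RHS]mulmxA.
by rewrite [(M *m T)^T *m _]mulmxA oQ mul1mx.
Qed.

Lemma gram_schmidt_SO M : 0 < \det M -> SO R n.+1 (gram_schmidt M).
Proof.
move=> dM; have uM : M \in unitmx by rewrite unitmxE unitfE gt_eqF.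
have oQ := gram_schmidt_orthogonal uM; split; first exact: mulmx1C.
have := congr1 (@determinant _ _) oQ; rewrite det_mulmx det_tr det1 -expr2.
move/eqP; rewrite sqrp_eq1 => [/eqP//|].
by rewrite ltW // det_mulmx mulr_gt0 // Up_plus_det_gt0 //; exact: gsU_Up.
Qed.

Lemma gram_schmidt_continuous (T : topologicalType) (F : T -> 'M[R]_n.+1) x :
  (forall t, F t \in unitmx) ->
  {for x, continuous F} -> {for x, continuous (gram_schmidt \o F)}.
Proof.
move=> uF cF.
have cF' i j : {for x, continuous (fun t => F t i j)} by exact: continuous_at_entry.
have cFt i j : {for x, continuous (fun t => (F t)^T i j)}.
  by apply: continuous_at_ext (cF' j i) => t; rewrite mxE.
have cS : {for x, continuous (fun t => (F t)^T *m F t)}.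
  by apply: continuous_at_mx; exact: continuous_mulmx.
have cT i j : {for x, continuous (fun t => gaussU ((F t)^T *m F t) i j)}.
  apply: (@continuous_at_ext _ _ ((fun A => gauss i (1%:M *m A) i j : R^o)
      \o (fun t => (F t)^T *m F t))); first by move=> t; rewrite /= mul1mx mxE.
  apply: continuous_comp => //; apply: (@gauss_smooth_pivots_pos R n 1%:M 0%N i i j) => /=.
  by rewrite mul1mx; exact: pivots_pos_gram.
have uT t : gaussU ((F t)^T *m F t) \in unitmx.
  exact/Up_plus_unit/gaussU_Up/pivots_pos_gram.
apply: continuous_at_mx; apply: continuous_mulmx => //; apply: continuous_mulmx.
  exact: continuous_invmx.
move=> i j; case: (eqVneq i j) => [->|ij].
  apply: (@continuous_at_ext _ _ (fun t => Num.sqrt (gaussU ((F t)^T *m F t) j j))).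
    by move=> t; rewrite !mxE eqxx mulr1n.
  apply: (@continuous_comp _ _ _ (fun t => gaussU ((F t)^T *m F t) j j) Num.sqrt) => //.
  exact: sqrt_continuous.
apply: (@continuous_at_ext _ _ (cst 0)); last exact: cst_continuous.
by move=> t; rewrite !mxE (negbTE ij).
Qed.

End GramSchmidt.

(** * The signed Bruhat cell in the space of matrices *)

Section Cell.
Variables (R : realType) (n : nat) (P : 'M[R]_n.+1) (s : 'S_n.+1).
Hypotheses (sP : signed_perm s P) (SOP : SO R n.+1 P).

Definition cell : set 'M[R]_n.+1 :=
  [set L *m P *m M | L in Up_plus R n.+1 & M in Up_plus R n.+1] `&` SO R n.+1.

Let PPt : P *m P^T = 1%:M. Proof. by case: SOP. Qed.
Let PtP : P^T *m P = 1%:M. Proof. exact: mulmx1C. Qed.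

Lemma signed_perm0 i j : j != s i -> P i j = 0.
Proof.
move=> ji; have : row i P 0 j = 0; last by rewrite mxE.
by case: (sP i) => ->; rewrite !mxE eqxx (negbTE ji) ?oppr0.
Qed.

Lemma signed_perm_sqr i : P i (s i) * P i (s i) = 1.
Proof.
have e : row i P 0 (s i) = P i (s i) by rewrite mxE.
by rewrite -!e; case: (sP i) => ->; rewrite !mxE !eqxx ?mulrNN mulr1.
Qed.

Lemma conj_entry (A : 'M[R]_n.+1) i j :
  (P *m A *m P^T) i j = P i (s i) * A (s i) (s j) * P j (s j).
Proof.
rewrite mxE (bigD1 (s j)) //= big1 ?addr0 => [|k kj].
  rewrite !mxE (bigD1 (s i)) //= big1 ?addr0 // => k ki.
  by rewrite signed_perm0 ?mul0r.
by rewrite [P^T k j]mxE signed_perm0 ?mulr0.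
Qed.

Lemma conjV_entry (A : 'M[R]_n.+1) i j :
  (P^T *m A *m P) (s i) (s j) = P i (s i) * A i j * P j (s j).
Proof.
rewrite mxE (bigD1 j) //= big1 ?addr0 => [|k kj].
  rewrite !mxE (bigD1 i) //= big1 ?addr0 ?mxE // => k ki.
  by rewrite mxE signed_perm0 ?mul0r // (inj_eq perm_inj) eq_sym.
by rewrite [P k _]signed_perm0 ?mulr0 // (inj_eq perm_inj) eq_sym.
Qed.

Lemma conj_support (A : 'M[R]_n.+1) : Lo1 R n.+1 A ->
  (forall i j : 'I_n.+1, (i < j)%N -> (s i < s j)%N -> A (s j) (s i) = 0) ->
  Up_plus R n.+1 (P *m A *m P^T).
Proof.
move=> [lA dA] hA; split=> [i j ji|i]; rewrite conj_entry.
  have [sij|sji|/val_inj/perm_inj ij] := ssrnat.ltngtP (s i) (s j).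
  - by rewrite lA // mulr0 mul0r.
  - by rewrite hA // mulr0 mul0r.
  by rewrite ij ltnn in ji.
by rewrite dA mulr1 signed_perm_sqr.
Qed.

(** An element V P W of the cell satisfies P^T V P = C with C triangular for
    the order of the indices transported by s; its factor L is then supported
    in the same order, and W is absorbed by the other factor. *)
Lemma cellP Q : SO R n.+1 Q -> cell Q <->
  pivots_pos (P^T *m Q) /\
  forall i j : 'I_n.+1, (i < j)%N -> (s i < s j)%N ->
    gaussL (P^T *m Q) (s j) (s i) = 0.
Proof.
move=> SOQ; split=> [[[V hV [W hW VW]] _]|[piv hL]]; last first.
  split=> //; exists (P *m gaussL (P^T *m Q) *m P^T).
    by apply: conj_support => //; exact: gaussL_Lo1.
  exists (gaussU (P^T *m Q)); first exact: gaussU_Up.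
  by rewrite -(mulmxA _ P^T) PtP mulmx1 -mulmxA -gauss_LU // mulmxA PPt mul1mx.
pose C := P^T *m V *m P.
(* V being upper triangular, P^T V P is supported in this order *)
pose r (a b : 'I_n.+1) := ((s^-1)%g a <= (s^-1)%g b)%N.
have tr : transitive r by move=> b a c; exact: leq_trans.
have asym : antisymmetric r.
  by move=> a b /anti_leq /val_inj /perm_inj.
have Cr a b : ~~ r a b -> C a b = 0.
  rewrite /r -ltnNge => ba; rewrite -(permKV s a) -(permKV s b) conjV_entry.
  by rewrite hV.1 // mulr0 mul0r.
have Cd (a : 'I_n.+1) : gauss a C a a = V ((s^-1)%g a) ((s^-1)%g a).
  rewrite (gauss_support_diag tr asym Cr) //.
  rewrite -[X in C X X](permKV s a) conjV_entry mulrAC signed_perm_sqr mul1r //.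
have pC : pivots_pos C by move=> a; rewrite Cd; exact: hV.2.
have EQ : P^T *m Q = gaussL C *m (gaussU C *m W).
  by rewrite mulmxA -gauss_LU // -VW !mulmxA.
have hLC := gaussL_Lo1 pC.
have hU : Up_plus R n.+1 (gaussU C *m W) by apply: Up_plus_mul => //; exact: gaussU_Up.
rewrite EQ; split; first exact: pivots_pos_LU.
move=> i j ij sij; rewrite gaussL_unique //; [|exact: hU.1|].
  rewrite mxE (gauss_support _ tr Cr) ?mul0r //.
  by rewrite /r !permK -ltnNge.
by move=> c; rewrite gt_eqF //; exact: hU.2.
Qed.

(** The unipotent matrices allowed by [cellP] form a convex set, which
    Gram-Schmidt maps continuously to the cell by multiplication on the right
    with upper triangular matrices. *)
Lemma cell_path Q : cell Q -> exists p : R -> 'M[R]_n.+1,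
  [/\ continuous p, forall t, cell (p t), p 0 = P & p 1 = Q].
Proof.
move=> cQ; have SOQ := cQ.2; have [piv hL] := (cellP SOQ).1 cQ.
set L := gaussL (P^T *m Q) in hL; set T := gaussU (P^T *m Q).
have lL : Lo1 R n.+1 L by exact: gaussL_Lo1.
have uT : Up_plus R n.+1 T by exact: gaussU_Up.
have QE : Q = P *m L *m T by rewrite -mulmxA -gauss_LU // mulmxA PPt mul1mx.
clearbody L T.
pose K (t : R) := 1%:M + t *: (L - 1%:M).
have hK t : Lo1 R n.+1 (K t).
  split=> [i j ij|i]; rewrite !mxE.
    by rewrite lL.1 // -val_eqE ltn_eqF // mulr0n subrr mulr0 addr0.
  by rewrite lL.2 eqxx subrr mulr0 addr0.
have dP : \det P = 1 by case: SOP.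
have dPK t : \det (P *m K t) = 1 by rewrite det_mulmx dP Lo1_det // mul1r.
have uPK t : P *m K t \in unitmx by rewrite unitmxE dPK unitr1.
have cPK (t : R) : {for t, continuous (fun u : R => P *m K u)}.
  apply: continuous_at_mx; apply: continuous_mulmx => i j; first exact: cst_continuous.
  apply: (@continuous_at_ext R R (fun u => (1%:M : 'M[R]_n.+1) i j + u * (L - 1%:M) i j)).
    by move=> u; rewrite !mxE.
  apply: continuousD; first exact: cst_continuous.
  by apply: continuousM; [by move=> A|exact: cst_continuous].
exists (@gram_schmidt R n \o (fun t => P *m K t)); split => /=.
- by move=> t; exact: gram_schmidt_continuous uPK (cPK t).
- move=> t; split; last by apply: gram_schmidt_SO; rewrite dPK.
  exists (P *m K t *m P^T).
    apply: conj_support => // i j ij sij; rewrite !mxE hL //.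
    have -> : (s j == s i) = false by rewrite (inj_eq perm_inj) -val_eqE gtn_eqF.
    by rewrite mulr0n subrr mulr0 addr0.
  exists (gsU (P *m K t)); first exact: gsU_Up.
  by rewrite -(mulmxA _ P^T) PtP mulmx1.
- have -> : K 0 = 1%:M by rewrite /K scale0r addr0.
  rewrite mulmx1 (@gram_schmidt_unique _ _ _ 1%:M) ?mulmx1 //.
    by rewrite unitmxE dP unitr1.
  by split=> [i j ji|i]; rewrite mxE ?eqxx // -val_eqE gtn_eqF.
have -> : K 1 = L by rewrite /K scale1r addrC subrK.
rewrite (@gram_schmidt_unique _ _ _ T) //.
- by rewrite unitmxE det_mulmx dP Lo1_det // mul1r unitr1.
by rewrite -QE; apply: mulmx1C; case: SOQ.
Qed.

End Cell.

(** * The entries of the lower factor as coordinates *)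

Section StrictLower.
Variables (R : realType) (m : nat).
Implicit Types A : 'M[R]_m.

Definition strict_lower A : 'M[R]_m := \matrix_(i, j) (if (j < i)%N then A i j else 0).

Lemma strict_lowerB A B : strict_lower (A - B) = strict_lower A - strict_lower B.
Proof. by apply/matrixP => i j; rewrite !mxE; case: ifP => _; rewrite ?mxE ?subr0. Qed.

Lemma strict_lower_upper A : upper_mx A -> strict_lower A = 0.
Proof. by move=> uA; apply/matrixP => i j; rewrite !mxE; case: ifP => // /uA. Qed.

Lemma strict_lower_id A : (forall i j : 'I_m, (i <= j)%N -> A i j = 0) -> strict_lower A = A.
Proof.
by move=> lA; apply/matrixP => i j; rewrite !mxE; case: ltnP => // /lA.
Qed.

Lemma upper_sub_strict_lower A : upper_mx (A - strict_lower A).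
Proof. by move=> i j ji; rewrite !mxE ji subrr. Qed.

Lemma Lo1_mul_strict_lower (L A : 'M[R]_m) (i j : 'I_m) :
  (forall i j : 'I_m, (i < j)%N -> L i j = 0) ->
  (forall i j : 'I_m, (i <= j)%N -> A i j = 0) -> (i <= j)%N -> (L *m A) i j = 0.
Proof.
move=> lL lA ij; rewrite mxE big1 // => k _.
have [ik|ki] := ltnP i k; first by rewrite lL ?mul0r.
by rewrite lA ?mulr0 // (leq_trans ki).
Qed.

End StrictLower.

Lemma diff_line (R : realType) (V : normedModType R) (f : V -> R^o) x v (c : R) :
  differentiable f x ->
  (\forall h \near (0 : R), f (h *: v + x) = f x + h * c) -> 'd f x v = c.
Proof.
move=> df fc; rewrite -(deriveE v df); apply: cvg_lim => //.
apply: (@cvg_trans _ (cst (c : R^o) @ (0 : R)^')); last exact: cvg_cst.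
apply: near_eq_cvg; near=> h.
have h0 : h != 0 by near: h; exact: nbhs_dnbhs_neq.
have fh : f (h *: v + x) = f x + h * c.
  by near: h; exact: nbhs_dnbhs.
by rewrite /= fh addrAC subrr add0r /GRing.scale /= mulKf.
Unshelve. all: by end_near. Qed.

Section Chart.
Variables (R : realType) (n : nat) (P : 'M[R]_n.+1).
Hypothesis SOP : SO R n.+1 P.
Let PtP : P^T *m P = 1%:M. Proof. by apply: mulmx1C; case: SOP. Qed.

Definition chart (a b : 'I_n.+1) (Q : 'M[R]_n.+1) : R^o := gaussL (P^T *m Q) a b.

Lemma chart_differentiable a b Q : pivots_pos (P^T *m Q) ->
  differentiable (chart a b) Q.
Proof. by move=> piv; have [h _] := @gaussL_smooth R n P^T a b 1; exact: h. Qed.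

Lemma chart_LU a b L T : Lo1 R n.+1 L -> upper_mx T ->
  (forall c, T c c != 0) -> chart a b (P *m L *m T) = L a b.
Proof.
by move=> hL uT dT; rewrite /chart !mulmxA PtP mul1mx gaussL_unique.
Qed.

(** Split K = T Z T^-1 into its strictly lower part K1 and an upper triangular
    K2.  As Q Z = P L K T, the variation of Q is the sum of P (L K1) T, which
    moves L to L + h L K1 with the same T, and of P L (K2 T), which moves only
    T. *)
Lemma chart_diff a b L T Z : Lo1 R n.+1 L -> Up_plus R n.+1 T ->
  'd (chart a b) (P *m L *m T) (P *m L *m T *m Z)
  = (L *m strict_lower (T *m Z *m invmx T)) a b.
Proof.
move=> hL hT; have uT := Up_plus_unit hT.
set Q := P *m L *m T; set K := T *m Z *m invmx T.
have KT : K *m T = T *m Z by rewrite mulmxKV.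
clearbody K; set X := L *m strict_lower K.
have XE : L *m K = X + L *m (K - strict_lower K) by rewrite -mulmxDr addrC subrK.
have lX (i j : 'I_n.+1) : (i <= j)%N -> X i j = 0.
  apply: Lo1_mul_strict_lower; first exact: hL.1.
  by move=> k l kl; rewrite mxE ltnNge kl.
clearbody X.
have dT c : T c c != 0 by rewrite gt_eqF //; exact: hT.2.
have dg : differentiable (chart a b) Q.
  apply: chart_differentiable; rewrite /Q !mulmxA PtP mul1mx.
  exact: pivots_pos_LU.
have gQ : chart a b Q = L a b by rewrite chart_LU //; exact: hT.1.
have -> : Q *m Z = P *m X *m T + P *m L *m ((K - strict_lower K) *m T).
  transitivity (P *m (L *m K) *m T); first by rewrite /Q -!mulmxA KT.
  by rewrite XE mulmxDr mulmxDl !mulmxA.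
rewrite linearD /=.
have -> : 'd (chart a b) Q (P *m X *m T) = X a b.
  apply: diff_line => //; near=> h.
  have -> : h *: (P *m X *m T) + Q = P *m (L + h *: X) *m T.
    by rewrite mulmxDr mulmxDl -scalemxAr -scalemxAl addrC.
  rewrite chart_LU ?gQ //; [by rewrite !mxE| |exact: hT.1].
  split=> [i j ij|i]; rewrite !mxE lX //; last by rewrite mulr0 addr0 hL.2.
    by rewrite mulr0 addr0 hL.1.
  exact: ltnW.
set N := (K - strict_lower K) *m T.
have uN : upper_mx N by apply: upper_mulmx; [exact: upper_sub_strict_lower|exact: hT.1].
clearbody N.
have -> : 'd (chart a b) Q (P *m L *m N) = 0; last by rewrite addr0.
apply: diff_line => //; near=> h.
have -> : h *: (P *m L *m N) + Q = P *m L *m (T + h *: N).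
  by rewrite mulmxDr -scalemxAr addrC.
rewrite mulr0 addr0 gQ chart_LU //.
  by move=> i j ji; rewrite !mxE uN // mulr0 addr0; exact: hT.1.
near: h; apply: filter_forall => c.
have cc : {for (0 : R), continuous (fun h : R => T c c + h * N c c)}.
  apply: continuousD; first exact: cst_continuous.
  by apply: continuousM; [by move=> A|exact: cst_continuous].
have : \forall h \near (0 : R), 0 < T c c + h * N c c.
  apply: (cc [set x | 0 < x]); apply: open_nbhs_nbhs; split; first exact: open_gt.
  by rewrite /= mul0r addr0; exact: hT.2.
by apply: filterS => h h0; rewrite !mxE gt_eqF.
Unshelve. all: by end_near. Qed.

(** To obtain the variation X of L, the strictly lower part of T Z T^-1 has
    to be L^-1 X.  Take for Z the antisymmetric matrix with the same strictly
    lower part as T^-1 L^-1 X T: the upper triangular discrepancy stays upper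
    triangular under conjugation by T. *)
Lemma chart_diff_surjective Q (X : 'M[R]_n.+1) : SO R n.+1 Q -> pivots_pos (P^T *m Q) ->
  (forall i j : 'I_n.+1, (i <= j)%N -> X i j = 0) ->
  exists2 Y, tangent_SO Q Y & forall a b, 'd (chart a b) Q Y = X a b.
Proof.
move=> SOQ piv lX; set L := gaussL (P^T *m Q); set T := gaussU (P^T *m Q).
have hL : Lo1 R n.+1 L by exact: gaussL_Lo1.
have hT : Up_plus R n.+1 T by exact: gaussU_Up.
have uT := Up_plus_unit hT; have uL := Lo1_unit hL.
have QE : Q = P *m L *m T.
  by rewrite -mulmxA -gauss_LU // mulmxA; case: SOP => -> _; rewrite mul1mx.
have lLi (i j : 'I_n.+1) : (i < j)%N -> invmx L i j = 0.
  move=> ij; have -> : invmx L i j = invmx L^T j i by rewrite -trmx_inv mxE.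
  apply: upper_invmx => //; last by rewrite unitmx_tr.
  by move=> k l lk; rewrite mxE hL.1.
pose X' := invmx L *m X.
have lX' (i j : 'I_n.+1) : (i <= j)%N -> X' i j = 0 by exact: Lo1_mul_strict_lower.
pose W := invmx T *m X' *m T; pose Z := strict_lower W - (strict_lower W)^T.
exists (Q *m Z).
  rewrite /tangent_SO /= mulmxA (mulmx1C SOQ.1) mul1mx.
  by rewrite /Z linearB /= trmxK opprB.
move=> a b; rewrite QE chart_diff //.
pose N := W - strict_lower W + (strict_lower W)^T.
have uN : upper_mx N.
  move=> i j ji; rewrite mxE upper_sub_strict_lower // add0r !mxE.
  by rewrite ltnNge ltnW.
have -> : Z = W - N by rewrite /N opprD opprB addrA addrCA subrr addr0.
have -> : T *m (W - N) *m invmx T = X' - T *m N *m invmx T.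
  by rewrite mulmxBr mulmxBl /W !mulmxA mulmxV // mul1mx mulmxK.
rewrite strict_lowerB strict_lower_id // strict_lower_upper ?subr0; first by rewrite /X' mulKVmx.
apply: upper_mulmx; last by apply: upper_invmx => //; exact: hT.1.
by apply: upper_mulmx => //; exact: hT.1.
Qed.

(** Below the diagonal Z is supported on the subdiagonal, and so is T Z T^-1;
    there the diagonals of T and T^-1 multiply its positive entries. *)
Lemma chart_diff_convex Q (kappa : 'I_n -> R) (j0 : 'I_n) :
  pivots_pos (P^T *m Q) -> (forall j, 0 < kappa j) ->
  0 < 'd (chart (lift ord0 j0) (widen_ord (leqnSn n) j0)) Q
    (Q *m \sum_(j < n) kappa j *: frak_a R j).
Proof.
move=> piv kpos; set L := gaussL (P^T *m Q); set T := gaussU (P^T *m Q).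
have hL : Lo1 R n.+1 L by exact: gaussL_Lo1.
have hT : Up_plus R n.+1 T by exact: gaussU_Up.
have uT := Up_plus_unit hT.
have QE : Q = P *m L *m T.
  by rewrite -mulmxA -gauss_LU // mulmxA; case: SOP => -> _; rewrite mul1mx.
clearbody L T; set Z := \sum_(j < n) _; set a := lift ord0 j0; set b := widen_ord _ j0.
have av : a = j0.+1 :> nat by rewrite /= /bump.
have bv : b = j0 :> nat by [].
rewrite QE chart_diff // mxE (bigD1 a) //= hL.2 mul1r big1 ?addr0 => [|k ka].
  rewrite mxE av bv ltnSn.
  have Zab : Z a b = kappa j0.
    rewrite /Z summxE (bigD1 j0) //= big1 ?addr0 => [|j jj0].
      rewrite !mxE !eqxx /=; have -> : (a == b) = false.
        by apply/eqP => /(congr1 (@nat_of_ord n.+1)); rewrite av bv; lia.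
      by rewrite subr0 mulr1.
    rewrite !mxE -!val_eqE /= !/bump /= !add1n.
    have jn : (j0 == j :> nat) = false by rewrite eq_sym; exact: negbTE.
    rewrite eqSS jn /=; have [e|] := eqVneq j0.+1 (j : nat); last by rewrite subr0 mulr0.
    by rewrite -e ltn_eqF ?subr0 ?mulr0 // ltnW.
  (* rows from a on and columns up to b meet the band of Z only at (a, b) *)
  have Z0 (i k : 'I_n.+1) : (a <= i)%N -> (k <= b)%N -> (i, k) != (a, b) -> Z i k = 0.
    rewrite av bv => ai kb ik; rewrite /Z summxE big1 // => j _.
    rewrite !mxE -!val_eqE /= !/bump /= !add1n.
    have -> : (i == j :> nat) && (k == j.+1 :> nat) = false.
      by apply/negbTE/negP => /andP[/eqP ij /eqP kj]; lia.
    have -> : (i == j.+1 :> nat) && (k == j :> nat) = false.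
      apply/negbTE/negP => /andP[/eqP ij /eqP kj]; move/negP: ik; apply.
      by rewrite xpair_eqE; apply/andP; split; apply/eqP/ord_inj;
        rewrite ?av ?bv; lia.
    by rewrite subrr mulr0.
  have uTi : upper_mx (invmx T) by apply: upper_invmx => //; exact: hT.1.
  rewrite mxE (bigD1 b) //= big1 ?addr0 => [|k kb].
    rewrite mxE (bigD1 a) //= big1 ?addr0 => [|i ia].
      rewrite Zab !mulr_gt0 //; first exact: hT.2.
      exact: (Up_plus_invmx hT).2.
    have [lt_ia|le_ai] := ltnP i a; first by rewrite hT.1 // mul0r.
    by rewrite Z0 ?mulr0 // xpair_eqE negb_and ia.
  have [lt_bk|le_kb] := ltnP b k; first by rewrite uTi // mulr0.
  rewrite mxE big1 ?mul0r // => i _.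
  have [lt_ia|le_ai] := ltnP i a; first by rewrite hT.1 // mul0r.
  by rewrite Z0 ?mulr0 // xpair_eqE negb_and kb orbT.
have [lt_ak|le_ka] := ltnP a k; first by rewrite hL.1 // mul0r.
rewrite mxE ifF ?mulr0 //; apply/negbTE; rewrite -leqNgt bv -ltnS -av.
by rewrite ltn_neqAle le_ka andbT (inj_eq (@ord_inj _)).
Qed.

End Chart.

(** * Components of the preimage of a path connected set *)

Section Covering.
Variables (R : realType) (X Y : topologicalType) (B : set Y) (p : X -> Y).
Hypothesis dcp : double_covering B p.

Lemma double_covering_fiber x y z : p x = p y -> p x = p z ->
  [\/ x = y, y = z | x = z].
Proof.
move=> xy xz; have [cp pB evenly] := dcp.
have [W [V [[oW Wx] oV _ VW hV]]] := evenly (p x) (pB x).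
have inV u : p u = p x -> exists b, V b u.
  move=> ux; have : (p @^-1` W) u by rewrite /= ux.
  by rewrite VW => -[?|?]; [exists true|exists false].
have injV b u v : V b u -> V b v -> p u = p v -> u = v.
  move=> Vu Vv uv; have [_ _ [t [_ _ tp _]]] := hV b.
  by rewrite -(tp u Vu) -(tp v Vv) uv.
have [b Vx] := inV x erefl.
have [c Vy] := inV y (esym xy); have [d Vz] := inV z (esym xz).
case: (eqVneq b c) => [bc|bc].
  by rewrite -bc in Vy; constructor 1; exact: injV Vx Vy xy.
case: (eqVneq b d) => [bd|bd].
  by rewrite -bd in Vz; constructor 3; exact: injV Vx Vz xz.
have cd : c = d by case: b c d bc bd {Vx Vy Vz} => [] [] [].
rewrite -cd in Vz; constructor 2; apply: injV Vy Vz _.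
by rewrite -xy.
Qed.

(** The times t whose fibre meets the component form an open and closed set:
    over a small interval, a local section of the covering carries the path
    to a connected set, which lies in the component as soon as it meets it. *)
Lemma path_component (C : set Y) (g : R -> Y) x0 : C `<=` B ->
  continuous g -> (forall t, C (g t)) -> p x0 = g 0 ->
  forall t, exists2 x, connected_component (p @^-1` C) x0 x & p x = g t.
Proof.
move=> CB cg Cg px0; have [cp pB evenly] := dcp.
pose S := [set t | exists2 x, connected_component (p @^-1` C) x0 x & p x = g t].
have loc t0 : exists2 J : set R, open_nbhs t0 J &
    forall t1 t2, J t1 -> J t2 -> S t1 -> S t2.
  have [W [V [[oW Wt] oV _ VW hV]]] := evenly (g t0) (CB _ (Cg t0)).
  have /nbhs_ballP[e /= e0 eW] : \forall t \near t0, W (g t).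
    by apply: (cg t0); exact: open_nbhs_nbhs.
  exists (ball t0 e); first by split; [exact: ball_open|exact: ballxx].
  move=> t1 t2 J1 J2 [x xC pxt].
  have [b Vx] : exists b, V b x.
    have : (p @^-1` W) x by rewrite /= pxt; exact: eW.
    by rewrite VW => -[?|?]; [exists true|exists false].
  have [_ _ [s [/subspace_continuousP cs _ sp ps]]] := hV b.
  have WB t : ball t0 e t -> (W `&` B) (g t).
    by move=> /eW Wt'; split=> //; exact/CB/Cg.
  have cJ : connected (ball t0 e).
    by apply/connected_intervalP; rewrite ball_itv; exact: interval_is_interval.
  have csg : {within ball t0 e, continuous (s \o g)}.
    apply/subspace_continuousP => t Jt N Ns.
    have := cg t _ (cs _ (WB t Jt) _ Ns).
    change ((\forall u \near t, (W `&` B) (g u) -> N (s (g u))) ->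
      \forall u \near t, ball t0 e u -> N (s (g u))).
    by apply: filterS => u Nu Ju; apply: Nu; exact: WB.
  have := connected_continuous_connected cJ csg => cI.
  exists (s (g t2)); last by apply: ps; exact: WB.
  apply: (connected_component_trans xC).
  apply: (@connected_component_max _ _ ((s \o g) @` ball t0 e)) => //.
  - by exists t1 => //=; rewrite -pxt sp.
  - by move=> _ [u Ju <-] /=; rewrite ps; [exact: Cg|exact: WB].
  by exists t2.
have S0 : S 0.
  by exists x0 => //; apply: connected_component_refl; rewrite /= px0; exact: Cg.
suff ST : S = setT by move=> t; have : S t by rewrite ST.
have cR : connected [set: R] by apply/connected_intervalP => x y _ _ z _.
apply: cR; first by exists 0.
- exists S; last by rewrite setTI.
  rewrite openE => t St; have [J [oJ Jt] JS] := loc t.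
  by apply: filterS (open_nbhs_nbhs (conj oJ Jt)) => u Ju; exact: JS Jt Ju St.
exists S; last by rewrite setTI.
rewrite -[S]setCK; apply: open_closedC; rewrite openE => t nSt.
have [J [oJ Jt] JS] := loc t.
apply: filterS (open_nbhs_nbhs (conj oJ Jt)) => u Ju Su.
by apply: nSt; exact: JS Ju Jt Su.
Qed.

End Covering.

Lemma connectedU1_closure (T : topologicalType) (A : set T) (b : T) :
  connected A -> closure A b -> connected (A `|` [set b]).
Proof.
move=> cA Ab U U0 [C1 oC1 C1E] [C2 cC2 C2E]; rewrite eqEsubset {1}C2E; split.
  exact: subIsetl.
have AbA : A `|` [set b] `<=` closure A.
  by move=> x [/subset_closure//|->].
suff AU : A `<=` C2.
  rewrite C2E subsetI; split=> // x /AbA.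
  by move/(closureS AU); move/closure_id : cC2 => <-.
suff <- : A `&` U = A by rewrite C2E => x [_ []].
apply: cA.
- move: U0; rewrite C1E => -[z [/AbA zA C1z]].
  have [w [Aw C1w]] := zA _ (open_nbhs_nbhs (conj oC1 C1z)).
  by exists w; split=> //; split=> //; left.
- by exists C1 => //; rewrite C1E setIA (setIidl (@subsetUl _ _ _)).
- by exists C2 => //; rewrite C2E setIA (setIidl (@subsetUl _ _ _)).
Qed.

Section SpinComponent.
Variables (R : realType) (n : nat) (G : topGroupType) (Pi : G -> 'M[R]_n.+1).
Hypothesis PiM : forall x y : G, Pi (x * y)%g = Pi x *m Pi y.
Hypothesis dPi : double_covering (SO R n.+1) Pi.

Lemma mulgr_continuous (z : G) : continuous (fun x : G => (x * z)%g).
Proof.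
move=> x; apply: (@continuous_comp _ _ _ (fun x : G => (x, z))
  (fun u : G * G => (u.1 * u.2)%g)); last exact: mulg_continuous.
by apply: cvg_pair; [exact: cvg_id|exact: cvg_cst].
Qed.

(** A point w' of the preimage outside B lies over a point w of B, so
    zeta = w^-1 w' is a nontrivial element of the kernel.  The fibres having at
    most two points, the complement of B is contained in B zeta.  A point of B
    adherent to the connected set B zeta would put w' = w zeta in the component
    B. *)
Lemma component_closure_compl (C : set 'M[R]_n.+1) (z0 : G) :
  (forall Q, C Q ->
    exists2 x, connected_component (Pi @^-1` C) z0 x & Pi x = Q) ->
  let B := connected_component (Pi @^-1` C) z0 in
  B `<=` ~` closure ((Pi @^-1` C) `\` B).
Proof.
move=> onto B b Bb clb.
have [w' [[/= Cw' nBw'] _]] := clb setT filterT.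
have [w Bw ww'] := onto _ Cw'.
pose zeta := (w^-1 * w')%g.
have uPi x : Pi x \in unitmx.
  have [_ /(_ x) [_ dx] _] := dPi; by rewrite unitmxE dx unitr1.
have Pz : Pi zeta = 1%:M.
  apply: (can_inj (mulKmx (uPi w))).
  by rewrite -PiM /zeta mulgA mulgV mul1g mulmx1.
have zn1 : zeta <> 1%g.
  move=> z1; apply: nBw'; suff -> : w' = w by [].
  by rewrite -[RHS]mulg1 -z1 /zeta mulgA mulgV mul1g.
pose Bz := (fun x : G => (x * zeta)%g) @` B.
have sub : (Pi @^-1` C) `\` B `<=` Bz.
  move=> v [/= Cv nBv]; have [u Bu uv] := onto _ Cv.
  have [||uvE|vuz|uuz] := @double_covering_fiber _ _ _ _ dPi u v (u * zeta)%g.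
  - by [].
  - by rewrite PiM Pz mulmx1.
  - by rewrite -uvE in nBv.
  - by exists u.
  case: zn1; apply: (@mulgI _ u); by rewrite mulg1.
have cBz : connected Bz.
  apply: connected_continuous_connected; first exact: component_connected.
  exact/continuous_subspaceT/mulgr_continuous.
have := connectedU1_closure cBz (closureS sub clb) => cBb.
apply: nBw'; apply: (connected_component_trans Bb).
apply: (@connected_component_max _ _ (Bz `|` [set b])) => //.
- by right.
- move=> x [[y By <-]|->] /=; last exact: (connected_component_sub Bb).
  by rewrite PiM Pz mulmx1; exact: (connected_component_sub By).
by left; exists w => //; rewrite /zeta mulgA mulgV mul1g.
Qed.

End SpinComponent.

(** * Non-inversions, and the theorem *)

Section NonInversions.
Variable n : nat.
Implicit Types s : 'S_n.+1.

Definition noninv s := [pred p : 'I_n.+1 * 'I_n.+1 | (p.1 < p.2)%N && (s p.1 < s p.2)%N].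

Lemma card_noninv s : (ninv (eta_perm n.+1) - ninv s)%N = #|noninv s|.
Proof.
pose A := [pred p : 'I_n.+1 * 'I_n.+1 | (p.1 < p.2)%N].
pose B := [pred p : 'I_n.+1 * 'I_n.+1 | (s p.2 < s p.1)%N].
have -> : ninv (eta_perm n.+1) = #|A|.
  apply: eq_card => -[i j]; rewrite !inE /= !permE /=.
  by apply/andP/idP => [[]//|ij]; split=> //; move: (ltn_ord j) (ltn_ord i); lia.
rewrite -(cardID B A).
have -> : ninv s = #|[predI A & B]| by apply: eq_card => -[i j]; rewrite !inE.
rewrite addKn; apply: eq_card => -[i j]; rewrite !inE /= andbC.
have [ij|//] := boolP (i < j)%N; rewrite /= -leqNgt leq_eqVlt.
case: eqP => // /val_inj /perm_inj e.
by rewrite e ltnn in ij.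
Qed.

(** Otherwise the inverse of s decreases at each step; a decreasing sequence of
    n + 1 values between 0 and n is the reversal. *)
Lemma exists_ascent s : s <> eta_perm n.+1 ->
  exists j : 'I_n, ((s^-1)%g (widen_ord (leqnSn n) j) < (s^-1)%g (lift ord0 j))%N.
Proof.
move=> sne; apply/existsP; apply/contraT => /existsPn desc; case: sne.
set u := (s^-1)%g in desc *.
have dec (i : nat) : (i < n)%N -> (u (inord i.+1) < u (inord i))%N.
  move=> il; have := desc (Ordinal il); rewrite -leqNgt.
  have -> : widen_ord (leqnSn n) (Ordinal il) = inord i.
    by apply: val_inj; rewrite /= inordK // ltnW.
  have -> : lift ord0 (Ordinal il) = inord i.+1.
    by apply: val_inj; rewrite /= inordK.
  rewrite leq_eqVlt => /orP[/eqP/val_inj/perm_inj|//].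
  move=> /(congr1 (@nat_of_ord n.+1)).
  by rewrite inordK // inordK ?ltnS ?(ltnW il) // => /esym/n_Sn.
have up (i : nat) : (i <= n)%N -> (u (inord i) + i <= n)%N.
  elim: i => [|i IH] il; first by rewrite addn0 -ltnS ltn_ord.
  by have := dec _ il; have := IH (ltnW il); lia.
have lo (i : nat) : (i <= n)%N -> (i <= u (inord (n - i)))%N.
  elim: i => [|i IH] il //; have := IH (ltnW il).
  have il' : (n - i.+1 < n)%N by lia.
  by have := dec _ il'; rewrite -subSn // subSS; lia.
have uE (i : 'I_n.+1) : u i = rev_ord i.
  apply: val_inj => /=; have il : (i <= n)%N by rewrite -ltnS.
  have := up _ il; have := lo _ (leq_subr i n); rewrite subKn // inord_val.
  by rewrite subSS; lia.
apply/permP => i; rewrite permE; apply: (canLR (permKV s)).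
by rewrite -/u uE rev_ordK.
Qed.

End NonInversions.

Theorem theorem2 (R : realType) (n : nat) (hn : (2 <= n)%N)
    (Spin : topGroupType) (Pi : Spin -> 'M[R]_n.+1) (hPi : spin_covering Pi)
    (z0 : Spin) (hz0 : B_tilde Pi z0)
    (sigma : 'S_n.+1) (hsigma : signed_perm sigma (Pi z0))
    (hne : sigma <> eta_perm n.+1) :
  let k := (ninv (eta_perm n.+1) - ninv sigma)%N in
  (0 < k)%N /\
  exists (U : set Spin) (f : Spin -> 'rV[R]_k),
    [/\ open U /\ Bru Pi z0 `<=` U,
        forall i : 'I_k, smooth_on_spin Pi U (fun z => f z 0 i),
        forall z, U z -> (Bru Pi z0 z <-> f z = 0),
        forall z, U z -> dspin_surjective Pi f z &
        forall (eps : R) (Gamma : R -> Spin), 0 < eps ->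
          smooth_curve Pi (- eps) eps Gamma ->
          locally_convex_curve Pi (- eps) eps Gamma ->
          (forall t, t \in `]- eps, eps[ -> U (Gamma t)) ->
          forall (last : 'I_k), last.+1 = k ->
          forall t, t \in `]- eps, eps[ ->
            derivable (fun s => f (Gamma s) 0 last : R^o) t 1 /\
            0 < derive1 (fun s => f (Gamma s) 0 last : R^o) t].
Proof.
move=> k; have [PiM dPi _] := hPi.
have [cPi SOPi _] := dPi.
set P := Pi z0 in hsigma; have SOP : SO R n.+1 P by exact: SOPi.
have [j0 asc] := exists_ascent hne.
pose a0 := lift ord0 j0; pose b0 := widen_ord (leqnSn n) j0.
pose p0 := ((sigma^-1)%g b0, (sigma^-1)%g a0).
have p0N : p0 \in noninv sigma.
  rewrite inE /= asc !permKV /= /bump; lia.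
(* the non-inversions, the one that gives a subdiagonal entry being last *)
pose e := rcons (rem p0 (enum (noninv sigma))) p0.
have e_perm : perm_eq e (enum (noninv sigma)).
  by rewrite perm_rcons perm_sym; apply: perm_to_rem; rewrite mem_enum.
have se : size e = k.
  by rewrite (perm_size e_perm) -cardE -card_noninv.
have ue : uniq e by rewrite (perm_uniq e_perm) enum_uniq.
have me p : (p \in e) = (p \in noninv sigma).
  by rewrite (perm_mem e_perm) mem_enum.
have k0 : (0 < k)%N by rewrite -se size_rcons.
split=> //.
pose row_of (i : nat) := sigma (nth p0 e i).2.
pose col_of (i : nat) := sigma (nth p0 e i).1.
pose f (z : Spin) : 'rV[R]_k :=
  \row_(i < k) chart P (row_of i) (col_of i) (Pi z).
have fE z i : f z 0 i = chart P (row_of i) (col_of i) (Pi z) by rewrite mxE.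
pose C := cell P; pose B := Bru Pi z0.
pose A := [set Q | pivots_pos (P^T *m Q)].
pose U := (Pi @^-1` A) `&` ~` closure ((Pi @^-1` C) `\` B).
have onto Q : C Q -> exists2 x, B x & Pi x = Q.
  move=> /(cell_path hsigma SOP) [p [cp Cp p0E p1E]].
  have [||x Bx px] := @path_component _ _ _ _ _ dPi C p z0 _ cp Cp _ 1.
  - by move=> ? [].
  - by rewrite p0E.
  by exists x => //; rewrite px.
have BC : B `<=` Pi @^-1` C by exact: connected_component_sub.
have CA z : (Pi @^-1` C) z -> A (Pi z).
  by move=> /(cellP hsigma SOP (SOPi z)) [].
have UA z : U z -> A (Pi z) by case.
exists U, f; split.
- split.
    apply: openI; last by rewrite openC; exact: closed_closure.
    by apply: open_comp => [x _|]; [exact: cPi|exact: open_pivots_pos].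
  move=> z Bz; split; first exact/CA/BC.
  exact: (component_closure_compl PiM dPi onto).
- move=> i z Uz; exists A, (chart P (row_of i) (col_of i)); split.
  + exact: open_pivots_pos.
  + exact: UA.
  + exact: gaussL_smooth.
  by apply: filterE => w; rewrite fE.
- move=> z Uz; split=> [Bz|fz].
    have [_ hL] := (cellP hsigma SOP (SOPi z)).1 (BC _ Bz).
    apply/rowP => i; rewrite fE [RHS]mxE.
    have : nth p0 e i \in noninv sigma by rewrite -me mem_nth // se.
    by rewrite inE => /andP[h1 h2]; exact: hL.
  apply: contrapT => nBz; case: Uz => Az; apply; apply: subset_closure; split=> //.
  apply/(cellP hsigma SOP (SOPi z)); split=> // i j ij sij.
  have pe : (i, j) \in e by rewrite me inE /= ij.
  have ik : (index (i, j) e < k)%N by rewrite -se index_mem.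
  by have := fE z (Ordinal ik); rewrite fz mxE /row_of /col_of /= nth_index //.
- move=> z Uz y.
  pose X : 'M[R]_n.+1 := \sum_(i < k) y 0 i *: delta_mx (row_of i) (col_of i).
  have eN i : (i < k)%N -> nth p0 e i \in noninv sigma.
    by move=> ik; rewrite -me mem_nth // se.
  have X0 (i j : 'I_n.+1) : (i <= j)%N -> X i j = 0.
    move=> ij; rewrite /X summxE big1 // => l _; rewrite !mxE.
    have := eN l (ltn_ord l); rewrite inE => /andP[_ h].
    case: eqP => [ir|_]; last by rewrite mulr0.
    case: eqP => [jc|_]; last by rewrite mulr0.
    by move: h ij; rewrite ir jc => h; rewrite leqNgt h.
  have XE (i : 'I_k) : X (row_of i) (col_of i) = y 0 i.
    rewrite /X summxE (bigD1 i) //= big1 ?addr0 => [|l li].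
      by rewrite !mxE !eqxx mulr1.
    rewrite !mxE /row_of /col_of !(inj_eq perm_inj).
    have -> : ((nth p0 e i).2 == (nth p0 e l).2) && ((nth p0 e i).1 == (nth p0 e l).1) = false.
      apply/negbTE; rewrite andbC -xpair_eqE -!surjective_pairing.
      by rewrite nth_uniq ?se // eq_sym.
    by rewrite mulr0.
  have [Y tY dY] := chart_diff_surjective SOP (SOPi z) (UA z Uz) X0.
  exists Y => // i; exists (chart P (row_of i) (col_of i)); split.
  + by apply: chart_differentiable; exact: UA.
  + by apply: filterE => w; rewrite fE.
  by rewrite dY XE.
move=> eps Gamma eps0 [_ smG] [_ _ convG] UG last lastk t tI.
have elast : nth p0 e last = p0.
  rewrite nth_rcons; have : size e = last.+1 by rewrite se.
  by rewrite size_rcons => -[->]; rewrite ltnn eqxx.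
have -> : (fun s => f (Gamma s) 0 last : R^o) = chart P a0 b0 \o (Pi \o Gamma).
  by apply/funext => u; rewrite fE /row_of /col_of elast /= !permKV.
have tI' : [set` `]- eps, eps[] t by [].
have dG : differentiable (Pi \o Gamma : R^o -> 'M[R]_n.+1) t.
  by have [h _] := smG 1%N; exact: h.
have AG := UA _ (UG t tI).
have dc : differentiable (chart P a0 b0) ((Pi \o Gamma) t).
  exact: chart_differentiable.
have dcG : differentiable (chart P a0 b0 \o (Pi \o Gamma) : R^o -> R^o) t.
  exact: differentiable_comp.
split; first exact/derivable1_diffP.
have [kappa kpos kE] : exists2 kappa : 'I_n -> R, (forall j, 0 < kappa j) &
  invmx (Pi (Gamma t)) *m derive1 (Pi \o Gamma) t = \sum_(j < n) kappa j *: frak_a R j.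
  by apply: convG => //; exact/derivable1_diffP.
have uG : Pi (Gamma t) \in unitmx by have [_ d1] := SOPi (Gamma t); rewrite unitmxE d1 unitr1.
rewrite derive1E' // diff_comp //= -derive1E' //.
have -> : derive1 (Pi \o Gamma) t = Pi (Gamma t) *m \sum_(j < n) kappa j *: frak_a R j.
  by rewrite -kE mulKVmx.
exact: chart_diff_convex.
Qed.
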